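(* Let $d\ge1$, let $\mathbb P$ be a probability law on $\mathbb R^d$, let $\mathbf X_1,\mathbf X_2,\dots$ be independent random vectors with law $\mathbb P$, and let $\mathbb P_n=\frac1n\sum_{i=1}^n\delta_{\{\mathbf X_i\}}$. For any $\mathbf z\in\mathbb R^d$ and any sequence $\delta_n\downarrow0$ it holds that $$D_{\delta_n}(\mathbf z|\mathbb P_n)\to D_0(\mathbf z|\mathbb P)\quad\text{almost surely as }n\to\infty.$$
   Context: $\delta_{\{\mathbf x\}}$ is the Dirac mass at $\mathbf x$, $\|\cdot\|$ the Euclidean norm, $\langle\cdot,\cdot\rangle$ the Euclidean inner product. For laws $\mathbb Q,\mathbb Q'$ on $\mathbb R^d$ (no moment assumption) the Wasserstein distance is $d_W(\mathbb Q,\mathbb Q')=\inf_\Pi\int\|\mathbf x-\mathbf y\|\,\Pi(\mathrm d\mathbf x,\mathrm d\mathbf y)\in[0,\infty]$, over all joint laws $\Pi$ with marginals $\mathbb Q,\mathbb Q'$. The robustified halfspace depth is $$D_\delta(\mathbf z|\mathbb Q)=\inf_{\|\mathbf u\|=1}\ \sup_{\mathbb Q':d_W(\mathbb Q',\mathbb Q)\le\delta}\mathbb Q'(\{\mathbf x:\langle\mathbf u,\mathbf x-\mathbf z\rangle\ge0\}),$$ and $D_0(\mathbf z|\mathbb Q)=\inf_{\|\mathbf u\|=1}\mathbb Q(\{\mathbf x:\langle\mathbf u,\mathbf x-\mathbf z\rangle\ge0\})$ is the classical halfspace depth. *)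

(* Defs.v *)
From HB Require Import structures.
From mathcomp Require Import all_boot all_order all_algebra finmap.
From mathcomp Require Import all_classical all_reals all_analysis.

Set Implicit Arguments.
Unset Strict Implicit.
Unset Printing Implicit Defensive.

Import Order.TTheory GRing.Theory Num.Theory.
Import numFieldNormedType.Exports.

Local Open Scope classical_set_scope.
Local Open Scope ring_scope.

(* R^d is [d.-tuple (measurableTypeR R)]: its canonical sigma-algebra is the
   d-fold product of the Borel sigma-algebra of R, i.e., the Borel sets of R^d. *)
Notation Rvec R d := (d.-tuple (measurableTypeR R)).

Section euclidean.
Context {R : realType} {d : nat}.
Implicit Types x y : Rvec R d.

Definition vsub x y : Rvec R d := [tuple tnth x i - tnth y i | i < d].

Definition inner x y : R := \sum_(i < d) tnth x i * tnth y i.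

Definition enorm x : R := Num.sqrt (inner x x).

Definition halfspace (u z : Rvec R d) : set (Rvec R d) :=
  [set x | 0 <= inner u (vsub x z)].

End euclidean.

Section depth.
Context {R : realType} {d : nat}.
Implicit Types (Q : probability (Rvec R d) R) (z : Rvec R d).
Local Open Scope ereal_scope.

(* Marginals are compared on measurable sets only, since the value of a measure
   elsewhere carries no meaning. *)
Definition coupling Q Q'
    (Pi : probability (Rvec R d * Rvec R d)%type R) : Prop :=
  forall A : set (Rvec R d), measurable A ->
    Pi (fst @^-1` A) = Q A /\ Pi (snd @^-1` A) = Q' A.

Definition wasserstein Q Q' : \bar R :=
  ereal_inf [set \int[Pi]_p (enorm (vsub p.1 p.2))%:E | Pi in coupling Q Q'].

Definition robust_depth (delta : R) z Q : \bar R :=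
  ereal_inf [set
    ereal_sup [set Q' (halfspace u z) | Q' in
                [set Q' : probability (Rvec R d) R
                   | wasserstein Q' Q <= delta%:E]]
    | u in [set u : Rvec R d | enorm u = 1%R]].

Definition halfspace_depth z Q : \bar R :=
  ereal_inf [set Q (halfspace u z) | u in [set u : Rvec R d | enorm u = 1%R]].

End depth.

Section empirical.
Context {d : measure_display} {T : measurableType d} {R : realType}.
Variables (x : nat -> T) (n : nat).

(* The sample is x_0, ..., x_n, so the weights are 1/(n+1). *)
Definition empirical : set T -> \bar R :=
  mscale (n.+1%:R^-1)%:nng (msum (fun i => \d_(x i)) n.+1).

HB.instance Definition _ := Measure.on empirical.

Let empirical_setT : empirical [set: T] = 1%E.
Proof.
rewrite /empirical /mscale /= /msum.
rewrite (eq_bigr (fun=> 1%E)) => [|i _]; last by rewrite /= diracT.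
rewrite sumEFin -EFinM; congr (_%:E).
by rewrite big_const_ord iter_addr addr0 mulVf// pnatr_eq0.
Qed.

HB.instance Definition _ :=
  Measure_isProbability.Build _ _ _ empirical empirical_setT.

End empirical.

Arguments empirical {d T} R x n _.

Section iid.
Context {d dT : measure_display} {Omega : measurableType d}
  {T : measurableType dT} {R : realType}.
Variable Pr : probability Omega R.
Local Open Scope ereal_scope.

Definition independent_rvs (X : nat -> {RV Pr >-> T}) : Prop :=
  forall (J : {fset nat}) (A : nat -> set T),
    (forall i, i \in J -> measurable (A i)) ->
    Pr (\bigcap_(i in [set` J]) (X i @^-1` A i)) =
    \prod_(i <- J) Pr (X i @^-1` A i).

Definition has_law (X : {RV Pr >-> T}) (Q : probability T R) : Prop :=
  forall A, measurable A -> distribution Pr X A = Q A.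

End iid.

(* Main.v *)
Require Import Defs.
From mathcomp Require Import all_boot all_order all_algebra finmap.
From mathcomp Require Import all_classical all_reals all_analysis.
From mathcomp Require Import measurable_realfun ring lra zify.

Import Order.TTheory GRing.Theory Num.Theory.
Import numFieldNormedType.Exports.

Local Open Scope classical_set_scope.
Local Open Scope ring_scope.

(** By the strong law of large numbers, P_n(A) -> P(A) almost surely for each
    fixed measurable set A.

    Upper bound: choose u with P(H_u) close to the depth. If Q' is within
    Wasserstein distance delta of P_n then, by Markov's inequality applied to a
    near-optimal coupling, Q'(H_u) is at most delta / eta (up to an arbitrarily
    small error) plus the P_n-mass of the strip <u, x - z> >= - eta, and the
    latter mass is close to P(H_u) for small eta and large n.

    Lower bound: it suffices to bound P_n(H_u) from below uniformly in u. If
    this failed, there would be an ultrafilter of unit vectors containing the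
    complement of every set of directions on which the uniform bound holds.
    Along an ultrafilter the sign of <u, x> is governed by a lexicographic flag
    of limit directions; hence the limit halfspace is an increasing union of
    measurable sets L_m, each contained in H_u for most u, and so is its
    complement, with sets M_m disjoint from H_u for most u. The latter gives
    P(U L_m) >= D_0(z|P), so a single L_m has mass at least D_0(z|P) - e, and
    the law of large numbers for that L_m gives the bound on a set of
    directions in the ultrafilter, a contradiction. *)

(** * Limits and signs of linear forms along an ultrafilter *)

(** By compactness of [-1, 1] the image of [U] clusters at some [p]. An ultrafilter converges to its
    cluster points: otherwise the complement of a ball around [p] would belong to it and yet meet
    that ball. *)
Lemma ultra_bounded_cvg (R : realType) (T : Type) (U : set_system T)
    (h : T -> R) : UltraFilter U -> U [set t | `|h t| <= 1] ->
  exists p, forall e, 0 < e -> U [set t | `|h t - p| < e].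
Proof.
move=> UU hb.
have : (h @ U) `[(-1 : R), 1]%classic.
  rewrite /fmap /=; apply: filterS hb => t /=.
  by rewrite in_itv/= ler_norml.
move=> /(@segment_compact _ _ _ (h @ U) _)[p [_ clp]].
exists p => e e0.
have [//|Un] := in_ultra_setVsetC [set t | `|h t - p| < e] UU.
have Ub : (h @ U) (~` ball p e).
  rewrite /fmap/=; apply: filterS Un => t /=; rewrite -ball_normE/=.
  by rewrite distrC.
by have [y []] := clp _ _ Ub (nbhsx_ballx p e e0).
Qed.

Section measurable_comparison.
Context (R : realType) (d : measure_display) (S : measurableType d).
Variables (F : S -> R) (mF : measurable_fun setT F).

Lemma measurable_preimage_gt0 : measurable [set s | 0 < F s].
Proof.
rewrite (_ : [set _ | _] = setT `&` F @^-1` `]0, +oo[%classic); last first.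
  by rewrite setTI; apply/seteqP; split => s /=; rewrite in_itv/= andbT.
exact: mF.
Qed.

Lemma measurable_preimage_ge (a : R) : measurable [set s | a <= F s].
Proof.
rewrite (_ : [set _ | _] = setT `&` F @^-1` `[a, +oo[%classic); last first.
  by rewrite setTI; apply/seteqP; split => s /=; rewrite in_itv/= andbT.
exact: mF.
Qed.

Lemma measurable_preimage_eq0 : measurable [set s | F s = 0].
Proof.
rewrite (_ : [set _ | _] = setT `&` F @^-1` [set 0]); last first.
  by rewrite setTI; apply/seteqP; split.
exact: mF.
Qed.

End measurable_comparison.

Lemma ultra_finite_exists (T : Type) (U : set_system T) (I : finType)
    (A : I -> set T) : UltraFilter U ->
  U [set t | exists i, A i t] -> exists i, U (A i).
Proof.
move=> UU UA; apply: contrapT => nA.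
have : U [set t | forall i, ~ A i t].
  apply: filter_forall => i.
  by have [Ai|//] := in_ultra_setVsetC (A i) UU; case: nA; exists i.
move=> /(filterI UA) /filter_ex[t [[i Ai] /(_ i)]]; exact.
Qed.

(** Induction on the number of coordinates. The coefficients [f] are arbitrary functions of an
    abstract index [t], because eliminating a coordinate replaces them by other functions of [t]. *)
Lemma ultra_sign_split (R : realType) (T : Type) (U : set_system T)
    (dS : measure_display) (S : measurableType dS) (k : nat)
    (g : 'I_k -> S -> R) (f : T -> 'I_k -> R) :
  UltraFilter U -> (forall j, measurable_fun setT (g j)) ->
  exists L M : nat -> set S,
    (forall m, [/\ measurable (L m), measurable (M m),
      L m `<=` L m.+1, M m `<=` M m.+1 &
      U [set t | (forall s, L m s -> 0 <= \sum_j f t j * g j s) /\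
                 (forall s, M m s -> \sum_j f t j * g j s < 0)]]) /\
    (forall s, exists m, L m s \/ M m s).
Proof.
move=> UU; elim: k g f => [|k IH] g f mg.
  exists (fun=> setT), (fun=> set0); split=> [m|s]; last by exists 0%N; left.
  split => //; apply: filterE => t; split => // s _.
  by rewrite big_ord0.
have [U0|Un0] := in_ultra_setVsetC [set t | forall j, f t j = 0] UU.
  exists (fun=> setT), (fun=> set0); split=> [m|s]; last by exists 0%N; left.
  split => //; apply: filterS U0 => t f0; split => // s _.
  by rewrite big1// => j _; rewrite f0 mul0r.
(* There are finitely many coordinates, so a single [i] has the coefficient of largest modulus for
   [U]-most [t]. Dividing by that modulus keeps all coefficients in [-1, 1]. *)
have : U [set t | exists i, f t i != 0 /\ forall j, `|f t j| <= `|f t i|].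
  apply: filterS Un0 => t /= /existsNP[j0 /eqP fj0].
  have [i _ /= iP] := @Order.TotalTheory.arg_maxP _ R _ j0 xpredT
    (fun j => `|f t j|) isT.
  exists i; split => [|j]; last exact: iP.
  by rewrite -normr_gt0 (lt_le_trans _ (iP j0 isT))// normr_gt0.
move=> /(@ultra_finite_exists _ _ _ _ UU)[i Ui].
pose h t j := f t j / `|f t i|.
have /choice[e eP] : forall j, exists p, forall c, 0 < c ->
    U [set t | `|h t j - p| < c].
  move=> j; apply: (@ultra_bounded_cvg _ _ _ (h^~ j)).
  apply: filterS Ui => t /= [fi0 /(_ j) fij].
  by rewrite normrM normfV normr_id ler_pdivrMr ?normr_gt0// mul1r.
(* The normalised coefficient at [i] has modulus 1, so its limit cannot vanish. *)
have ei0 : e i != 0.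
  apply/eqP => ei; have := eP i _ (@ltr01 R).
  move=> /(filterI Ui)/filter_ex[t /= [[fi0 _]]].
  by rewrite ei subr0 normrM normfV normr_id divff ?normr_eq0// ltxx.
(* Where E s <> 0 its sign decides; on E s = 0 the coordinate i is eliminated
   and the induction hypothesis applies. *)
pose E s := \sum_j e j * g j s.
pose N s := \sum_j `|g j s|.
have mE : measurable_fun setT E.
  by apply: measurable_sum => j; apply: measurable_funM => //; exact: mg.
have mN : measurable_fun setT N.
  apply: measurable_sum => j; apply: measurableT_comp => //; exact: mg.
have N0 s : 0 <= N s by apply: sumr_ge0.
have [L' [M' [LM' cov']]] := IH (fun j => g (lift i j))
  (fun t j => f t (lift i j) - f t i * (e (lift i j) / e i))
  (fun j => mg (lift i j)).
(* [N s / (m + 1)] bounds the error of replacing [h t] by its limit [e] once all coefficients are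
   within 1/(m + 1). Where [E s] or [- E s] exceeds this error, the sign is settled. *)
pose L m := [set s | 0 < E s - m.+1%:R^-1 * N s] `|` ([set s | E s = 0] `&` L' m).
pose M m := [set s | 0 < - E s - m.+1%:R^-1 * N s] `|` ([set s | E s = 0] `&` M' m).
have elim_i t s : E s = 0 -> \sum_j f t j * g j s =
    \sum_j (f t (lift i j) - f t i * (e (lift i j) / e i)) * g (lift i j) s.
  rewrite /E (bigD1_ord i)//= => E0.
  have gi : g i s = - (\sum_j e (lift i j) * g (lift i j) s) / e i.
    apply: (mulfI ei0); rewrite mulrCA divff// mulr1.
    by apply/eqP; rewrite -addr_eq0 E0.
  rewrite (bigD1_ord i)//= gi mulrA mulrN mulr_sumr mulNr mulr_suml.
  rewrite addrC -sumrB; apply: eq_bigr => j _.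
  by rewrite mulrBl; congr (_ - _); ring.
have inv_dec m : (m.+2%:R^-1 : R) <= m.+1%:R^-1.
  by rewrite lef_pV2 ?posrE// ler_nat.
have mLN (m : nat) : measurable_fun setT (fun s => m.+1%:R^-1 * N s).
  by apply: measurable_funM => //; exact: measurable_cst.
exists L, M; split=> [m|s]; last first.
  have [E0|Eneg|Epos] := ltgtP 0 (E s).
  - have [m mP] : exists m, m.+1%:R^-1 * N s < E s.
      (* Dividing by [N s + 1] rather than [N s] avoids a zero denominator. *)
      have := @near_infty_natSinv_lt R (PosNum (divr_gt0 E0 (ltr_wpDl (N0 s) ltr01))).
      move=> /filter_ex[m /= mP]; exists m.
      rewrite ltr_pdivlMr in mP; last by rewrite ltr_wpDl.
      by rewrite (le_lt_trans _ mP)// ler_pM2l ?invr_gt0// lerDl.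
    by exists m; left; left => /=; rewrite subr_gt0.
  - have [m mP] : exists m, m.+1%:R^-1 * N s < - E s.
      rewrite -oppr_gt0 in Eneg.
      have := @near_infty_natSinv_lt R (PosNum (divr_gt0 Eneg (ltr_wpDl (N0 s) ltr01))).
      move=> /filter_ex[m /= mP]; exists m.
      rewrite ltr_pdivlMr in mP; last by rewrite ltr_wpDl.
      by rewrite (le_lt_trans _ mP)// ler_pM2l ?invr_gt0// lerDl.
    by exists m; right; left => /=; rewrite subr_gt0.
  - have [m [Lm|Mm]] := cov' s; exists m; [left|right]; by right.
have [mL' mM' L'S M'S U'] := LM' m.
split.
- apply: measurableU; last by apply: measurableI => //; exact: measurable_preimage_eq0.
  by apply: measurable_preimage_gt0; apply: measurable_funB.
- apply: measurableU; last by apply: measurableI => //; exact: measurable_preimage_eq0.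
  by apply: measurable_preimage_gt0; apply: measurable_funB => //; exact: measurable_funN.
- move=> s [/= Ls|[/= Es /L'S]]; last by right.
  by left; rewrite /= (lt_le_trans Ls)// lerB// ler_wpM2r.
- move=> s [/= Ls|[/= Es /M'S]]; last by right.
  by left; rewrite /= (lt_le_trans Ls)// lerB// ler_wpM2r.
have Uh : U [set t | forall j, `|h t j - e j| < m.+1%:R^-1].
  by apply: filter_forall => j; apply: eP; rewrite invr_gt0.
apply: filterS (filterI U' (filterI Ui Uh)) => t /= [[tL tM] [[fi0 _] th]].
(* The positive factor [|f t i|] does not affect signs, so it is enough to compare the normalised
   form with [E]. *)
have Sh s : \sum_j f t j * g j s = `|f t i| * \sum_j h t j * g j s.
  rewrite mulr_sumr; apply: eq_bigr => j _.
  by rewrite /h mulrA [_ * (_ / _)]mulrC divfK// normr_eq0.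
have hE s : `|\sum_j h t j * g j s - E s| <= m.+1%:R^-1 * N s.
  rewrite -sumrB (le_trans (ler_norm_sum _ _ _))// mulr_sumr ler_sum// => j _.
  by rewrite -mulrBl normrM ler_wpM2r// ltW.
split=> s [/= Es|[/= E0 s']].
- rewrite Sh mulr_ge0//; move: (hE s) Es; rewrite ler_norml.
  by move: (_ * N s) (\sum_j h t j * g j s) (E s) => a b c /andP[]; lra.
- by rewrite elim_i//; exact: tL.
- rewrite Sh pmulr_rlt0 ?normr_gt0//; move: (hE s) Es; rewrite ler_norml.
  by move: (_ * N s) (\sum_j h t j * g j s) (E s) => a b c /andP[]; lra.
- by rewrite elim_i//; exact: tM.
Qed.

(** * Strict bounds along limits, and measurability of halfspaces *)

Lemma cvge_near_gt (R : realType) (v : nat -> \bar R) (l a : \bar R) :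
  v n @[n --> \oo] --> l -> (a < l)%E -> \forall n \near \oo, (a < v n)%E.
Proof. by move=> + /open_ereal_gt'; apply. Qed.

Lemma cvge_near_lt (R : realType) (v : nat -> \bar R) (l a : \bar R) :
  v n @[n --> \oo] --> l -> (l < a)%E -> \forall n \near \oo, (v n < a)%E.
Proof. by move=> + /open_ereal_lt'; apply. Qed.

Section euclidean_measurability.
Context {R : realType} {d : nat}.
Implicit Types u z : Rvec R d.

Lemma measurable_tnth_vsub z (i : 'I_d) :
  measurable_fun setT (fun x => tnth (vsub x z) i).
Proof.
rewrite (_ : (fun x => _) = (fun x => tnth x i - tnth z i)); last first.
  by apply/funext => x; rewrite tnth_mktuple.
by apply: measurable_funB => //; exact: measurable_tnth.
Qed.

Lemma measurable_inner_vsub u z :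
  measurable_fun setT (fun x => inner u (vsub x z)).
Proof.
apply: measurable_sum => i; apply: measurable_funM => //.
exact: measurable_tnth_vsub.
Qed.

Lemma measurable_halfspace u z : measurable (halfspace u z).
Proof. by apply: measurable_preimage_ge; exact: measurable_inner_vsub. Qed.

End euclidean_measurability.

(** * Lower bound, uniform over all halfspaces *)

Lemma near_halfspace_ge (R : realType) (d : nat) (P : probability (Rvec R d) R)
    (dO : measure_display) (Omega : measurableType dO)
    (Pr : probability Omega R) (mu : nat -> Omega -> probability (Rvec R d) R)
    (z : Rvec R d) (e : R) :
  (forall A, measurable A -> {ae Pr, forall w, mu n w A @[n --> \oo] --> P A}) ->
  0 < e ->
  {ae Pr, forall w, \forall n \near \oo, forall u : Rvec R d, enorm u = 1 ->
    (halfspace_depth z P - e%:E <= mu n w (halfspace u z))%E}.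
Proof.
move=> muP e0; apply: contrapT => nae.
set D := halfspace_depth z P.
(* [F] holds the sets of directions outside which the uniform bound is valid. Intersecting two
   members only unites two null sets, and an empty member would be the claim itself, so the failure
   of the claim makes [F] a proper filter. *)
pose F : set_system (Rvec R d) := [set A |
  {ae Pr, forall w, \forall n \near \oo, forall u : Rvec R d, enorm u = 1 ->
     ~ A u -> (D - e%:E <= mu n w (halfspace u z))%E}].
have FF : ProperFilter F.
  apply: Build_ProperFilter_ex.
    move=> A FA; apply: contrapT => A0; apply: nae.
    move: FA; rewrite /F /=; apply: filterS => w; apply: filterS => n h u u1.
    apply: h => //.
    by move=> Au; apply: A0; exists u.
  split.
  - by rewrite /F /=; apply: filterE => w; apply: nearW => n u _ [].
  - move=> A B; rewrite /F /=; apply: filterS2 => w; apply: filterS2 => n hA hB u u1.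
    by move=> /not_andP[]; [exact: hA|exact: hB].
  - move=> A B AB; rewrite /F /=; apply: filterS => w; apply: filterS => n h u u1 nB.
    by apply: h => // /AB.
have [U [UU FU]] := ultraFilterLemma FF.
have U1 : U [set u | enorm u = 1].
  by apply: FU; rewrite /F /=; apply: filterE => w; exact: nearW.
have Dle u : enorm u = 1 -> (D <= P (halfspace u z))%E.
  by move=> u1; apply: ereal_inf_lbound; exists u.
have Dfin : D \is a fin_num.
  have [u0 u01] := filter_ex U1.
  rewrite ge0_fin_numE ?(le_lt_trans (Dle _ u01))//.
    by rewrite (le_lt_trans (probability_le1 _ _)) ?ltry//; exact: measurable_halfspace.
  by apply: le_ereal_inf_tmp => _ [u _ <-].
have [L [M [LM cov]]] := @ultra_sign_split R _ U _ (Rvec R d) d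
  (fun i x => tnth (vsub x z) i) (fun u i => tnth u i) UU
  (fun i => measurable_tnth_vsub z i).
have mL m : measurable (L m) by case: (LM m).
have mM m : measurable (M m) by case: (LM m).
have mUL : measurable (\bigcup_m L m) by exact: bigcup_measurable.
have mUM : measurable (\bigcup_m M m) by exact: bigcup_measurable.
have ndL : nondecreasing_seq L.
  by apply/nondecreasing_seqP => m; apply/subsetPset; case: (LM m).
have ndM : nondecreasing_seq M.
  by apply/nondecreasing_seqP => m; apply/subsetPset; case: (LM m).
have cL : P (L m) @[m --> \oo] --> P (\bigcup_m L m).
  exact: nondecreasing_cvg_mu.
have cM : P (M m) @[m --> \oo] --> P (\bigcup_m M m).
  exact: nondecreasing_cvg_mu.
(* [M m] is disjoint from [halfspace u z] for some unit [u], and that halfspace has mass at least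
   [D]. *)
have PM m : (P (M m) <= 1 - D)%E.
  have [_ _ _ _ /(filterI U1)/filter_ex[u [/= u1 [_ Mu]]]] := LM m.
  rewrite leeBrDr//; apply: (le_trans (leeD2l _ (Dle u u1))).
  rewrite -measureU//; last 2 first.
  - exact: measurable_halfspace.
  - apply/seteqP; split => // x [/= /Mu + ux].
    by rewrite ltNge; move/negP; apply; exact: ux.
  by apply: probability_le1; apply: measurableU => //; exact: measurable_halfspace.
have PUM : (P (\bigcup_m M m) <= 1 - D)%E.
  have /cvg_lim <- // := cM.
  by apply: lime_le; [apply/cvg_ex; eexists; exact: cM|exact: nearW].
have PUL : (D <= P (\bigcup_m L m))%E.
  have : (1 <= P (\bigcup_m L m) + P (\bigcup_m M m))%E.
    rewrite -(@probability_setT _ _ _ P) (le_trans _ (measureU2 _ _ _))//.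
    apply: le_measure; rewrite ?inE//; first exact: measurableU.
    by move=> x _; have [m [Lm|Mm]] := cov x; [left|right]; exists m.
  move=> /le_trans/(_ (leeD2l _ PUM)).
  by rewrite addeA leeBrDr// [leLHS]addeC leeD2rE.
have [m Lm] : exists m, (D - e%:E < P (L m))%E.
  have : (D - e%:E < P (\bigcup_m L m))%E.
    by rewrite (lt_le_trans _ PUL)// lteBlDr// lteDl// lte_fin.
  move=> /(cvge_near_gt _ _ _ _ cL)/filter_ex[m mP].
  by exists m.
(* For every [u] whose halfspace contains [L m], the convergence on the single set [L m] gives the
   bound. So the complement of this set of directions is in [U], although [U] contains the set
   itself. *)
have FL : F (~` [set u | L m `<=` halfspace u z]).
  rewrite /F /=; apply: filterS (muP _ (mL m)) => w cLw.
  near=> n => u u1 /contrapT Lu.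
  apply: (@le_trans _ _ (mu n w (L m))); last first.
    by apply: le_measure; rewrite ?inE//; exact: measurable_halfspace.
  apply: ltW; near: n.
  exact: cvge_near_gt cLw Lm.
have [_ _ _ _ UL] := LM m.
by have [u [nLu [Lu _]]] := filter_ex (filterI (FU _ FL) UL).
Unshelve. all: end_near. Qed.

(** * Cauchy-Schwarz and measurability of the Euclidean distance *)

Section euclidean_inner.
Context {R : realType} {d : nat}.
Implicit Types u v x y z : Rvec R d.

Lemma inner_ge0 x : 0 <= inner x x.
Proof. by apply: sumr_ge0 => i _; rewrite -expr2 sqr_ge0. Qed.

(** Cauchy-Schwarz: with c = <u, v> and u of norm 1, the squared norm of v - c u equals that of v
    minus c^2, and it is nonnegative. *)
Lemma inner_le_enorm u v : enorm u = 1 -> `|inner u v| <= enorm v.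
Proof.
move=> u1.
have uu : inner u u = 1 by rewrite -(sqr_sqrtr (inner_ge0 u)) -/(enorm u) u1 expr1n.
set c := inner u v.
have : 0 <= \sum_i (tnth v i - c * tnth u i) ^+ 2.
  by apply: sumr_ge0 => i _; exact: sqr_ge0.
rewrite (_ : \sum_i _ = inner v v - c ^+ 2); last first.
  transitivity (\sum_i (tnth v i * tnth v i - (2 * c) * (tnth u i * tnth v i)
      + c ^+ 2 * (tnth u i * tnth u i))).
    by apply: eq_bigr => i _; ring.
  rewrite big_split/= sumrB -!mulr_sumr.
  rewrite -/(inner v v) -/(inner u v) -/(inner u u) uu -/c; ring.
rewrite subr_ge0 => cv.
by rewrite -sqrtr_sqr ler_sqrt// inner_ge0.
Qed.

Lemma inner_vsub_split u x y z :
  inner u (vsub x z) = inner u (vsub x y) + inner u (vsub y z).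
Proof.
rewrite /inner -big_split/=; apply: eq_bigr => i _.
by rewrite !tnth_mktuple; ring.
Qed.

Lemma enorm_vsubxx x : enorm (vsub x x) = 0.
Proof.
rewrite /enorm /inner big1 ?sqrtr0// => i _.
by rewrite tnth_mktuple subrr mul0r.
Qed.

Lemma measurable_enorm_vsub :
  measurable_fun setT (fun p : Rvec R d * Rvec R d => enorm (vsub p.1 p.2)).
Proof.
apply: (@measurableT_comp _ _ _ _ _ _ (@Num.sqrt R)).
  by apply: continuous_measurable_fun; exact: sqrt_continuous.
apply: measurable_sum => i.
have m : measurable_fun setT
    (fun p : Rvec R d * Rvec R d => tnth (vsub p.1 p.2) i).
  rewrite (_ : (fun p => _) = (fun p => tnth p.1 i - tnth p.2 i)); last first.
    by apply/funext => p; rewrite tnth_mktuple.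
  apply: measurable_funB.
    apply: (@measurableT_comp _ _ _ _ _ _ (fun x : Rvec R d => tnth x i)) => //.
    exact: measurable_tnth.
  apply: (@measurableT_comp _ _ _ _ _ _ (fun x : Rvec R d => tnth x i)) => //.
  exact: measurable_tnth.
exact: measurable_funM.
Qed.

End euclidean_inner.

(** * Halfspace mass over a Wasserstein ball *)

Section wasserstein_balls.
Context {R : realType} {d : nat}.
Implicit Types (Q : probability (Rvec R d) R) (z : Rvec R d).
Local Open Scope ereal_scope.

(** The image of [Q] under x -> (x, x) is a coupling of zero cost. *)
Lemma wasserstein_refl Q : wasserstein Q Q <= 0.
Proof.
pose dg (x : Rvec R d) := (x, x).
have mdg : measurable_fun setT dg by exact: measurable_fun_pair.
pose f : {mfun (Rvec R d) >-> (Rvec R d * Rvec R d)%type} :=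
  mfun_Sub (mem_set mdg : dg \in mfun).
pose Pi : probability (Rvec R d * Rvec R d)%type R := distribution Q f.
apply: ereal_inf_lbound; exists Pi.
  by move=> A mA; split.
rewrite /Pi ge0_integral_pushforward//=; last 2 first.
  by apply/measurable_EFinP; exact: measurable_enorm_vsub.
  by move=> p _; rewrite lee_fin sqrtr_ge0.
by rewrite integral0_eq// => x _ /=; rewrite enorm_vsubxx.
Qed.

(** A pair closer than [eta] whose first point lies in the halfspace has its second point in the
    enlarged one; Markov's inequality bounds the mass of the other pairs by [eps]. The strict
    hypothesis yields an actual coupling of cost below [eta * eps], with no minimiser required. *)
Lemma wasserstein_halfspace_le Q Q' (u z : Rvec R d) (eta eps : R) :
  enorm u = 1%R -> (0 < eta)%R ->
  wasserstein Q' Q < (eta * eps)%:E ->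
  Q' (halfspace u z) <= Q [set x | (- eta <= inner u (vsub x z))%R] + eps%:E.
Proof.
move=> u1 eta0 /ereal_inf_lt[_ [Pi cPi <-] IPi].
have mH := measurable_halfspace u z.
have mK : measurable [set x | (- eta <= inner u (vsub x z))%R].
  by apply: measurable_preimage_ge; exact: measurable_inner_vsub.
pose N := [set p : Rvec R d * Rvec R d | (eta <= enorm (vsub p.1 p.2))%R].
have mN : measurable N.
  by apply: measurable_preimage_ge; exact: measurable_enorm_vsub.
have [<- _] := cPi _ mH; have [_ <-] := cPi _ mK.
have mfH : measurable (fst @^-1` (halfspace u z) : set (Rvec R d * Rvec R d)).
  by rewrite -[X in measurable X]setTI; exact: measurable_fst.
set K := snd @^-1` _.
have mfK : measurable (K : set (Rvec R d * Rvec R d)).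
  by rewrite -[X in measurable X]setTI; exact: measurable_snd.
have PiN : Pi N <= eps%:E.
  have mf : measurable_fun setT (fun p : Rvec R d * Rvec R d =>
      (enorm (vsub p.1 p.2))%:E).
    by apply/measurable_EFinP; exact: measurable_enorm_vsub.
  have := @le_integral_abse _ _ _ Pi setT measurableT _ eta mf eta0.
  under eq_integral do rewrite gee0_abs ?lee_fin ?sqrtr_ge0//.
  rewrite setTI (_ : [set _ | _] = N); last first.
    by apply/seteqP; split => p /=; rewrite lee_fin ger0_norm// sqrtr_ge0.
  move=> /le_lt_trans/(_ IPi); rewrite EFinM lte_pmul2l ?lte_fin//.
  exact: ltW.
apply: (@le_trans _ _ (Pi (K `|` N))).
  apply: le_measure; rewrite ?inE//; first exact: measurableU.
  move=> [x y]/= Hx.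
  have [?|lt] := leP eta (enorm (vsub x y)); first by right.
  left; rewrite /K/=; move: Hx; rewrite /halfspace/= (inner_vsub_split _ _ y).
  have := inner_le_enorm u (vsub x y) u1; rewrite ler_norml => /andP[_].
  move: lt; move: (inner u (vsub x y)) (inner u (vsub y z)) (enorm _).
  by move=> a b c; lra.
by apply: (le_trans (measureU2 _ mfK mN)); exact: leeD2l.
Qed.
End wasserstein_balls.

(** * Strong law of large numbers for pairwise independent events *)

Lemma indic_Lfun2 (R : realType) (d : measure_display) (T : measurableType d)
    (Pr : probability T R) (B : set T) :
  measurable B -> (\1_B : T -> R) \in Lfun Pr 2%:E.
Proof.
move=> mB; rewrite inE; apply/andP; split; rewrite inE/=.
  exact: measurable_indic.
rewrite /finite_norm unlock poweR_lty//.
rewrite (eq_integral (EFin \o \1_B)) => [|x _].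
  by rewrite integral_indic// setIT (le_lt_trans (probability_le1 _ _))// ltry.
rewrite /= indicE; case: (_ \in _).
  by rewrite normr1 powR1.
by rewrite normr0 powR0.
Qed.

Lemma floor_sqrt (n : nat) : exists k, (k * k <= n < k.+1 * k.+1)%N.
Proof.
elim: n => [|n [k /andP[kn nk]]]; first by exists 0%N.
have [lt|ge] := ltnP n.+1 (k.+1 * k.+1); first by exists k; rewrite lt (leq_trans kn).
exists k.+1; rewrite ge/= (leq_ltn_trans nk)//.
by rewrite ltn_mul.
Qed.

Lemma sum_inv_sqr_le (R : realType) (n : nat) :
  \sum_(k < n) (k.+1%:R ^- 2 : R) <= 2.
Proof.
(* The remainder makes the induction close, since 1/(n + 1)^2 is at most 2/(n + 1) - 2/(n + 2). *)
suff : \sum_(k < n) (k.+1%:R ^- 2 : R) <= 2 - 2 / n.+1%:R.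
  by move=> /le_trans; apply; rewrite gerBl divr_ge0.
elim: n => [|n IH]; first by rewrite big_ord0 divr1 subrr.
rewrite big_ord_recr/= (le_trans (lerD IH (lexx _)))//.
rewrite -subr_ge0.
have -> : 2 - 2 / n.+2%:R - (2 - 2 / n.+1%:R + n.+1%:R ^- 2)
   = n%:R / (n.+1%:R ^+ 2 * n.+2%:R) :> R.
  rewrite -(natr1 n.+1) -(natr1 n).
  have n0 := @ler0n R n.
  by field; rewrite !gt_eqF//; lra.
by rewrite divr_ge0// mulr_ge0// exprn_ge0.
Qed.

Section pairwise_independent_events.
Context (R : realType) (d : measure_display) (T : measurableType d).
Variables (Pr : probability T R) (B : nat -> set T) (p : R).
Hypothesis mB : forall i, measurable (B i).
Hypothesis PrB : forall i, Pr (B i) = p%:E.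
Hypothesis PrBI : forall i j, i != j -> Pr (B i `&` B j) = (p * p)%:E.

Definition event_count (n : nat) : T -> R := \sum_(i < n) \1_(B i).

Lemma event_countS n : event_count n.+1 = event_count n \+ \1_(B n).
Proof. by rewrite /event_count big_ord_recr. Qed.

Lemma event_countE n w : event_count n w = \sum_(i < n) \1_(B i) w.
Proof. by rewrite /event_count fct_sumE. Qed.

Lemma event_count_Lfun2 n : event_count n \in Lfun Pr 2%:E.
Proof.
elim: n => [|n IH]; first by rewrite /event_count big_ord0; exact: Lfun_cst.
by rewrite event_countS rpredD ?lee1n//= => _; exact: indic_Lfun2.
Qed.

Let Lfun21 (f : T -> R) : f \in Lfun Pr 2%:E -> f \in Lfun Pr 1.
Proof. by apply: Lfun_subset12; exact: fin_num_measure. Qed.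

Lemma expectation_event_count n : ('E_Pr[event_count n] = (n%:R * p)%:E)%E.
Proof.
elim: n => [|n IH].
  by rewrite /event_count big_ord0 mul0r; exact: expectation_cst.
rewrite event_countS expectationD; last 2 first.
- by apply: Lfun21; exact: event_count_Lfun2.
- by apply: Lfun21; exact: indic_Lfun2.
by rewrite IH expectation_indic// PrB -EFinD -natr1 mulrDl mul1r.
Qed.

(** Additivity reduces this to pairs of distinct events, where pairwise independence gives p^2 -
    p^2. The condition [m <= n] keeps [B n] out of the count. *)
Lemma covariance_event_count m n : (m <= n)%N ->
  covariance Pr (event_count m) (\1_(B n)) = 0%E.
Proof.
elim: m => [|m IH] mn; first by rewrite /event_count big_ord0; exact: covariance_cst_l.
have h := indic_Lfun2 _ _ _ Pr.
rewrite event_countS covarianceDl//; last 3 first.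
- exact: event_count_Lfun2.
- exact: h.
- exact: h.
rewrite IH ?(ltnW mn)// add0e covarianceE; last 3 first.
- by apply: Lfun21; exact: h.
- by apply: Lfun21; exact: h.
- by apply: Lfun2_mul_Lfun1; exact: h.
rewrite !expectation_indic// !PrB.
rewrite (_ : \1_(B m) * \1_(B n) = \1_(B m `&` B n) :> (T -> R)); last first.
  by rewrite indicI.
rewrite expectation_indic; last exact: measurableI.
by rewrite PrBI ?ltn_eqF// -EFinM subee.
Qed.

Lemma event_prob_itv01 : 0 <= p <= 1.
Proof.
apply/andP; split; rewrite -lee_fin -(PrB 0%N) ?measure_ge0//.
exact: probability_le1.
Qed.

Lemma variance_event_count_le n : ('V_Pr[event_count n] <= n%:R%:E)%E.
Proof.
elim: n => [|n IH].
  by rewrite /event_count big_ord0 (_ : 0 = cst 0)// variance_cst.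
have h := indic_Lfun2 _ _ _ Pr _ (mB n).
rewrite event_countS varianceD//; last exact: event_count_Lfun2.
rewrite covariance_event_count// mule0 adde0 -natr1 EFinD leeD//.
rewrite varianceE// (_ : \1_(B n) ^+ 2 = \1_(B n) :> (T -> R)); last first.
  by rewrite -[in RHS](setIid (B n)) indicI expr2.
rewrite expectation_indic// PrB -EFin_expe -EFinB lee_fin.
have /andP[p0 p1] := event_prob_itv01; nra.
Qed.

Lemma event_count_chebyshev n (eps : R) : 0 < eps ->
  (Pr [set w | (eps <= `|event_count n w - n%:R * p|)%R] <= (eps ^- 2 * n%:R)%:E)%E.
Proof.
move=> e0.
have mf : measurable_fun setT (event_count n).
  by move: (event_count_Lfun2 n); rewrite inE => /andP[]; rewrite inE.
pose f : {RV Pr >-> R} := mfun_Sub (mem_set mf : event_count n \in mfun).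
have := @chebyshev _ _ _ Pr f eps e0.
rewrite /= expectation_event_count/= => /le_trans; apply.
by rewrite EFinM lee_pmul2l// ?lte_fin ?invr_gt0 ?exprn_gt0//; exact: variance_event_count_le.
Qed.

(** Each further event moves the centred count by 1 - p or by - p, hence by at most 1. *)
Lemma event_count_dist m n w : (m <= n)%N ->
  `|event_count n w - n%:R * p| <= `|event_count m w - m%:R * p| + (n - m)%:R.
Proof.
move=> /subnK <-; rewrite addnK; elim: (n - m)%N => [|k IH].
  by rewrite add0n addr0.
rewrite addSn event_countS/= -!natr1 [leRHS]addrA.
rewrite (_ : _ + _ - _ = (event_count (k + m) w - (k + m)%:R * p) +
   (\1_(B (k + m)) w - p)); last by ring.
rewrite (le_trans (ler_normD _ _))// lerD//.
have /andP[p0 p1] := event_prob_itv01.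
by rewrite indicE ler_norml; case: (_ \in _) => /=; lra.
Qed.

(* Borel-Cantelli along the perfect squares; the count changes by at most 2k
   between k^2 and (k + 1)^2. *)
Lemma near_event_frequency (e : R) : 0 < e -> {ae Pr, forall w,
  \forall n \near \oo, `|event_count n.+1 w / n.+1%:R - p| <= e + e}.
Proof.
move=> e0.
pose q k := (k.+1 * k.+1)%N.
pose A k := [set w | (e * (q k)%:R <= `|event_count (q k) w - (q k)%:R * p|)%R].
have mA k : measurable (A k).
  apply: measurable_preimage_ge; apply: measurableT_comp => //.
  apply: measurable_funB => //.
  by move: (event_count_Lfun2 (q k)); rewrite inE => /andP[]; rewrite inE.
have q0 k : 0 < ((q k)%:R : R) by rewrite ltr0n.
(* Chebyshev at the count q = (k + 1)^2 with threshold e q gives q / (e q)^2, which is summable in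
   k. *)
have PA k : (Pr (A k) <= (e ^- 2 * k.+1%:R ^- 2)%:E)%E.
  apply: (le_trans (event_count_chebyshev _ _ (mulr_gt0 e0 (q0 k)))).
  rewrite lee_fin exprMn invfM -mulrA ler_pM2l ?invr_gt0 ?exprn_gt0//.
  rewrite /q natrM -expr2 -exprM.
  have : (k.+1%:R : R) != 0 by [].
  by move: (k.+1%:R) => x x0; rewrite (_ : _ * _ = x ^- 2)//; field.
have PA0 : Pr (lim_sup_set A) = 0%E.
  apply: lim_sup_set_cvg0 => //.
  apply: (@le_lt_trans _ _ (e ^- 2 * 2)%:E); last exact: ltry.
  apply: lime_le; first by apply: is_cvg_nneseries.
  apply: nearW => n; rewrite big_mkord.
  apply: (@le_trans _ _ (\sum_(k < n) (e ^- 2 * k.+1%:R ^- 2)%:E)%E).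
    by apply: lee_sum => k _; exact: PA.
  rewrite sumEFin lee_fin -mulr_sumr ler_pM2l ?invr_gt0 ?exprn_gt0//.
  exact: sum_inv_sqr_le.
have mlA : measurable (lim_sup_set A).
  by apply: bigcap_measurable => // k _; exact: bigcup_measurable.
exists (lim_sup_set A); split => // w; apply: contra_notP => nA.
have [k0 k0P] : exists k0, forall k, (k0 <= k)%N -> ~ A k w.
  apply: contrapT => H; apply: nA => k0 _.
  apply: contrapT => H'; apply: H; exists k0 => k k0k Ak; apply: H'.
  by exists k.
have [K KP] : exists K : nat, 2 / e <= K%:R.
  by exists (Num.bound (2 / e)); rewrite ltW// archi_boundP// divr_ge0// ltW.
(* The root k of the last square up to n + 1 then reaches both bounds. The successor of [k0] appears
   because k^2 is [q (k - 1)]. *)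
exists (maxn k0.+1 K * maxn k0.+1 K)%N => // n /= Kn.
have [k /andP[kn nk]] := floor_sqrt n.+1.
have kM : (maxn k0.+1 K <= k)%N.
  rewrite leqNgt; apply/negP => lt.
  have : (k.+1 * k.+1 <= maxn k0.+1 K * maxn k0.+1 K)%N by rewrite leq_mul.
  by move=> /leq_trans/(_ Kn)/(leq_trans nk); rewrite ltnNge leqnSn.
have [k' kE] : exists k', k = k'.+1.
  by exists k.-1; rewrite prednK// (leq_trans _ kM)// leq_max.
have k0k' : (k0 <= k')%N by move: kM; rewrite geq_max kE ltnS => /andP[].
have {}KP : 2 / e <= k%:R.
  by apply: (le_trans KP); rewrite ler_nat; move: kM; rewrite geq_max => /andP[].
have /negP := k0P _ k0k'; rewrite -ltNge /q -kE => Ak.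
have n0 : 0 < (n.+1%:R : R) by [].
rewrite -(ler_pM2r n0) -[X in _ * X]gtr0_norm// -normrM mulrBl divfK ?gt_eqF//.
rewrite [p * _]mulrC (le_trans (event_count_dist _ _ _ kn))//.
have kn' : (k * k)%:R <= n.+1%:R :> R by rewrite ler_nat.
(* The count moves by at most 2k beyond k^2, and k >= 2/e turns this into at most e k^2. This is the
   second [e] of the bound; the first is the deviation at k^2. *)
have d2 : (n.+1 - k * k)%:R <= 2 * k%:R :> R.
  by rewrite -natrM ler_nat leq_subLR; move: nk; nia.
have e2 : 2 * k%:R <= e * (k * k)%:R :> R.
  by rewrite natrM mulrA ler_wpM2r// mulrC -ler_pdivrMr//.
rewrite mulrDl lerD//.
  by rewrite (le_trans (ltW Ak))// ler_pM2l.
by rewrite (le_trans d2)// (le_trans e2)// ler_pM2l.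
Qed.

(** The exceptional null set depends on the precision; restricting to the precisions 2/(j + 1)
    leaves a countable union of null sets. *)
Lemma event_frequency_cvg : {ae Pr, forall w,
  event_count n.+1 w / n.+1%:R @[n --> \oo] --> p}.
Proof.
have : {ae Pr, forall w, forall j, \forall n \near \oo,
    `|event_count n.+1 w / n.+1%:R - p| <= j.+1%:R^-1 + j.+1%:R^-1}.
  by apply: ae_foralln => j; apply: near_event_frequency; rewrite invr_gt0.
apply: filterS => w H; apply/cvgrPdist_le => e e0.
have e20 : 0 < e / 2 by rewrite divr_gt0.
have /filter_ex[j /= jP] := @near_infty_natSinv_lt R (PosNum e20).
apply: filterS (H j) => n nP; rewrite distrC (le_trans nP)//.
by move: jP; set c := _^-1; lra.
Qed.

End pairwise_independent_events.

(** * Almost sure convergence of empirical measures on a fixed set *)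

Lemma independent_rvs_pair (R : realType) (dO dT : measure_display)
    (Omega : measurableType dO) (T : measurableType dT)
    (Pr : probability Omega R) (X : nat -> {RV Pr >-> T}) (A : set T)
    (i j : nat) :
  independent_rvs X -> measurable A -> i != j ->
  (Pr (X i @^-1` A `&` X j @^-1` A) = Pr (X i @^-1` A) * Pr (X j @^-1` A))%E.
Proof.
move=> Xind mA ij.
have := Xind [fset i; j]%fset (fun=> A) (fun _ _ => mA).
rewrite (_ : \bigcap_(_ in _) _ = X i @^-1` A `&` X j @^-1` A); last first.
  apply/seteqP; split => w /= => [H|[Hi Hj] k /=].
    by split; apply: H; rewrite /= !inE eqxx ?orbT.
  by rewrite !inE => /orP[]/eqP ->.
by move=> ->; rewrite big_fsetU1 ?inE// big_seq_fset1.
Qed.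

Lemma empirical_cvg (R : realType) (dO dT : measure_display)
    (Omega : measurableType dO) (T : measurableType dT)
    (Pr : probability Omega R) (X : nat -> {RV Pr >-> T})
    (P : probability T R) (A : set T) :
  independent_rvs X -> (forall i, has_law (X i) P) -> measurable A ->
  {ae Pr, forall w, empirical R (fun i => X i w) n A @[n --> \oo] --> P A}.
Proof.
move=> Xind Xlaw mA.
pose B i := X i @^-1` A.
have mB i : measurable (B i).
  by rewrite -[X in measurable X]setTI; exact: (measurable_funP (X i)).
have fP : P A = (fine (P A))%:E by rewrite fineK// fin_num_measure.
have PrB i : Pr (B i) = (fine (P A))%:E by rewrite -fP -(Xlaw i).
have PrBI i j : i != j -> Pr (B i `&` B j) = (fine (P A) * fine (P A))%:E.
  by move=> ij; rewrite independent_rvs_pair// !PrB.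
apply: filterS (event_frequency_cvg R _ _ Pr B _ mB PrB PrBI) => w Hw.
rewrite fP (_ : (fun n => _) =
    EFin \o (fun n => event_count R _ _ B n.+1 w / n.+1%:R)).
  by apply: cvg_comp Hw _; exact: cvg_id.
apply/funext => n /=.
rewrite /empirical /mscale/= /msum event_countE mulrC EFinM -sumEFin.
by congr (_ * _)%E; apply: eq_bigr => i _; rewrite /= diracE indicE.
Qed.

(** * Upper bound for the robust depth *)

(** Continuity from above: the enlarged halfspaces decrease to the closed halfspace. *)
Lemma halfspace_strip_cvg (R : realType) (d : nat)
    (P : probability (Rvec R d) R) (u z : Rvec R d) :
  P [set x | - m.+1%:R^-1 <= inner u (vsub x z)] @[m --> \oo]
    --> P (halfspace u z).
Proof.
pose K m := [set x : Rvec R d | - m.+1%:R^-1 <= inner u (vsub x z)].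
have mK m : measurable (K m).
  by apply: measurable_preimage_ge; exact: measurable_inner_vsub.
have HK : halfspace u z = \bigcap_m K m.
  apply/seteqP; split => x /= => [Hx m _|Hx].
    by rewrite /K/= (le_trans _ Hx)// oppr_le0 invr_ge0.
  rewrite /halfspace/= leNgt; apply/negP => neg.
  rewrite -oppr_gt0 in neg.
  have /filter_ex[m /= mP] := @near_infty_natSinv_lt R (PosNum neg).
  have : - m.+1%:R^-1 <= inner u (vsub x z) by exact: Hx.
  by rewrite lerNl leNgt mP.
rewrite HK; apply: nonincreasing_cvg_mu => //.
- exact: (le_lt_trans (probability_le1 P (mK 0%N)) (ltry 1)).
- by rewrite -HK; exact: measurable_halfspace.
- apply/nonincreasing_seqP => m; apply/subsetPset => x; rewrite /K /=.
  by apply: le_trans; rewrite lerN2 lef_pV2 ?posrE// ler_nat.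
Qed.

Lemma near_robust_depth_le (R : realType) (d : nat) (P : probability (Rvec R d) R)
    (dO : measure_display) (Omega : measurableType dO)
    (Pr : probability Omega R) (mu : nat -> Omega -> probability (Rvec R d) R)
    (z : Rvec R d) (delta : nat -> R) (e : R) :
  (forall A, measurable A -> {ae Pr, forall w, mu n w A @[n --> \oo] --> P A}) ->
  delta @ \oo --> (0 : R) -> halfspace_depth z P \is a fin_num -> 0 < e ->
  {ae Pr, forall w, \forall n \near \oo,
    (robust_depth (delta n) z (mu n w) <= halfspace_depth z P + e%:E)%E}.
Proof.
move=> muP d0 Dfin e0.
have e20 : 0 < e / 2 by rewrite divr_gt0.
have [_ [u /= u1 <-] Pu] := lb_ereal_inf_adherent e20 Dfin.
have /filter_ex[m Pm] := cvge_near_lt _ _ _ _ (halfspace_strip_cvg _ _ P u z) Pu.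
set K := [set x | _] in Pm.
have mK : measurable K.
  by apply: measurable_preimage_ge; exact: measurable_inner_vsub.
have m0 : 0 < (m.+1%:R^-1 : R) by rewrite invr_gt0.
apply: filterS (muP _ mK) => w cK.
near=> n.
apply: ge_ereal_inf; eexists; first by exists u.
apply: ub_ereal_sup => _ [Q' /= Q'le <-].
(* Half of [e] pays for transport, with [eta] = 1/(m + 1) and [eps] = e/2, once [delta n] is below
   their product. The other half went into choosing [u] and the strip [K]. *)
apply: (@le_trans _ _ (mu n w K + (e / 2)%:E)%E).
  apply: wasserstein_halfspace_le => //.
  rewrite (le_lt_trans Q'le)// lte_fin; near: n.
  by apply: (cvgr_lt 0) => //; rewrite mulr_gt0.
rewrite [e in leRHS]splitr EFinD addeA leeD2r//.
by apply: ltW; near: n; exact: cvge_near_lt cK Pm.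
Unshelve. all: end_near. Qed.

(** * Comparison of the depths, finiteness and convergence *)

(** [Q] lies in its own Wasserstein ball, so it competes in each supremum. *)
Lemma halfspace_depth_le_robust (R : realType) (d : nat)
    (Q : probability (Rvec R d) R) (z : Rvec R d) (delta : R) :
  0 <= delta -> (halfspace_depth z Q <= robust_depth delta z Q)%E.
Proof.
move=> d0; apply: le_ereal_inf_tmp => _ [u /= u1 <-].
apply: (@le_trans _ _ (Q (halfspace u z))).
  by apply: ereal_inf_lbound; exists u.
apply: ereal_sup_ubound; exists Q => //=.
by rewrite (le_trans (wasserstein_refl Q))// lee_fin.
Qed.

(** A positive dimension supplies a unit vector; without one the infimum would be over the empty
    set, hence infinite. *)
Lemma halfspace_depth_fin_num (R : realType) (d : nat)
    (Q : probability (Rvec R d) R) (z : Rvec R d) :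
  (0 < d)%N -> halfspace_depth z Q \is a fin_num.
Proof.
move=> d0.
pose u : Rvec R d := [tuple (i == Ordinal d0)%:R | i < d].
have u1 : enorm u = 1.
  rewrite /enorm /inner (bigD1 (Ordinal d0))//= big1 => [|i /negPf i0].
    by rewrite tnth_mktuple eqxx mulr1 addr0 sqrtr1.
  by rewrite tnth_mktuple i0 mulr0.
rewrite ge0_fin_numE; last by apply: le_ereal_inf_tmp => _ [v _ <-].
apply: (@le_lt_trans _ _ (Q (halfspace u z))).
  by apply: ereal_inf_lbound; exists u.
by rewrite (le_lt_trans (probability_le1 _ _)) ?ltry//; exact: measurable_halfspace.
Qed.

Lemma cvge_squeeze (R : realType) (v : nat -> \bar R) (l : \bar R) :
  l \is a fin_num ->
  (forall j, \forall n \near \oo, (l - (j.+1%:R^-1)%:E <= v n)%E) ->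
  (forall j, \forall n \near \oo, (v n <= l + (j.+1%:R^-1)%:E)%E) ->
  v n @[n --> \oo] --> l.
Proof.
case: l => // l _ lo hi.
have vE j : \forall n \near \oo, exists2 r, v n = r%:E & `|l - r| <= j.+1%:R^-1.
  near=> n.
  have : (l%:E - (j.+1%:R^-1)%:E <= v n)%E by near: n; exact: lo.
  have : (v n <= l%:E + (j.+1%:R^-1)%:E)%E by near: n; exact: hi.
  case: (v n) => [r| |]; rewrite -?EFinB -?EFinD ?lee_fin ?leye_eq ?leeNy_eq//.
  by move: (_^-1) => c r1 r2; exists r => //; rewrite ler_norml; apply/andP; split; lra.
apply/fine_cvgP; split; first by apply: filterS (vE 0%N) => n [r ->].
apply/cvgrPdist_le => e e0.
have /filter_ex[j /= jP] := @near_infty_natSinv_lt R (PosNum e0).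
by apply: filterS (vE j) => n [r /= -> /le_trans]; apply; exact: ltW.
Unshelve. all: end_near. Qed.

Theorem corollary3 (R : realType) (d : nat) (hd : (1 <= d)%N)
    (P : probability (Rvec R d) R)
    (dO : measure_display) (Omega : measurableType dO)
    (Pr : probability Omega R)
    (X : nat -> {RV Pr >-> Rvec R d})
    (Xindep : independent_rvs X)
    (Xlaw : forall i, has_law (X i) P)
    (z : Rvec R d)
    (delta : nat -> R)
    (delta_noninc : nonincreasing_seq delta)
    (delta_cvg0 : delta @ \oo --> (0 : R)) :
  {ae Pr, forall w : Omega,
    (fun n : nat => robust_depth (delta n) z (empirical R (fun i => X i w) n))
      @ \oo --> halfspace_depth z P}.
Proof.
have Dfin := halfspace_depth_fin_num _ _ P z hd.
(* A nonincreasing sequence stays above its limit. *)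
have delta0 n : 0 <= delta n.
  have /cvg_lim <- // := delta_cvg0.
  by apply: nonincreasing_cvgn_ge => //; apply/cvg_ex; exists 0.
pose mu n w : probability (Rvec R d) R := empirical R (fun i => X i w) n.
have muP A : measurable A ->
    {ae Pr, forall w, mu n w A @[n --> \oo] --> P A}.
  by move=> mA; exact: empirical_cvg.
have lo : {ae Pr, forall w, forall j, \forall n \near \oo,
    forall u : Rvec R d, enorm u = 1 ->
    (halfspace_depth z P - (j.+1%:R^-1)%:E <= mu n w (halfspace u z))%E}.
  by apply: ae_foralln => j; apply: near_halfspace_ge => //; rewrite invr_gt0.
have hi : {ae Pr, forall w, forall j, \forall n \near \oo,
    (robust_depth (delta n) z (mu n w) <=
     halfspace_depth z P + (j.+1%:R^-1)%:E)%E}.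
  by apply: ae_foralln => j; apply: near_robust_depth_le => //; rewrite invr_gt0.
apply: filterS2 lo hi => w lo hi; apply: cvge_squeeze => // j.
apply: filterS (lo j) => n H.
(* The bound holds for all unit [u] at once, so it passes to the infimum, the classical depth of the
   empirical law. *)
apply: le_trans (halfspace_depth_le_robust _ _ _ _ _ (delta0 n)).
by apply: le_ereal_inf_tmp => _ [u /= u1 <-]; exact: H.
Qed.
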